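(* Let $c(n)$ denote the number of parking functions $\pi$ of length $n$ for which the digraph $G_\pi$ is connected. Then, as $n\to\infty$, $$c(n)\sim\sqrt{\pi/2}\cdot e\, n^{n-3/2},\qquad\text{so that}\qquad \frac{c(n)}{(n+1)^{n-1}}\sim\sqrt{\frac{\pi}{2n}},$$ where in these formulas $\pi$ and $e$ denote the usual numerical constants.
   Context: $[n]=\{1,\dots,n\}$. Parking functions: there are $n$ parking spaces $1,\dots,n$ in order on a one-way street and $n$ cars $C_1,\dots,C_n$ arriving in this order; car $C_i$ has preferred space $\pi_i\in[n]$, drives to space $\pi_i$ and parks in the first available space among $\pi_i,\pi_i+1,\dots,n$ (leaving unparked if there is none). The sequence $\pi=(\pi_1,\dots,\pi_n)$ is a parking function of length $n$ if all cars are able to park. The total number of parking functions of length $n$ is $(n+1)^{n-1}$. The digraph $G_\pi$ has vertex set $[n]$ and edges $i\to\pi_i$; it is connected if it has exactly one (weakly connected) component, equivalently exactly one directed cycle (loops count as cycles of length $1$). Writing $a(n,k)$ for the number of parking functions $\pi$ of length $n$ with $G_\pi$ connected and with a cycle of length $k$, one has $c(n)=\sum_{k=1}^n a(n,k)$. The notation $f(n)\sim g(n)$ means $f(n)/g(n)\to1$. *)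

(* Defs.v *)
From mathcomp Require Import all_boot all_order all_algebra.
From mathcomp Require Import boolp classical_sets functions reals topology.
From mathcomp Require Import normedtype sequences exp trigo.
Import numFieldNormedType.Exports.

Set Implicit Arguments.
Unset Strict Implicit.
Unset Printing Implicit Defensive.

(** Cars and spaces are both numbered from 0, so that [n] = {1, .., n} becomes
    ['I_n]; a preference sequence is an element of [{ffun 'I_n -> 'I_n}]. *)

Section Parking.
Local Open Scope nat_scope.
Variable n : nat.
Implicit Types (occ : {set 'I_n}) (p : 'I_n) (f : {ffun 'I_n -> 'I_n}).

(** [enum 'I_n] lists the spaces in increasing order, so the head below is the
    first available space; [None] means that the car leaves unparked. *)
Definition first_free occ p : option 'I_n :=
  ohead [seq s : 'I_n <- enum 'I_n | (p <= s) && (s \notin occ)].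

Definition park_car occ p : {set 'I_n} :=
  if first_free occ p is Some s then s |: occ else occ.

(** Spaces occupied when car [i] arrives, i.e. after cars [0, .., i.-1]. *)
Definition occupied_before f (i : 'I_n) : {set 'I_n} :=
  foldl park_car finset.set0 [seq f j | j : 'I_n <- enum 'I_n & j < i].

Definition is_parking f : bool :=
  [forall i : 'I_n, isSome (first_free (occupied_before f i) (f i))].

(** Adjacency in the digraph with edges [i -> f i], orientation forgotten. *)
Definition wadj f : rel 'I_n := [rel i j | (f i == j) || (f j == i)].

(** Exactly one weakly connected component; in particular false for [n = 0]. *)
Definition digraph_connected f : bool := n_comp (wadj f) [pred i : 'I_n | true] == 1.

End Parking.

Definition connected_parking_count (n : nat) : nat :=
  #|[set f : {ffun 'I_n -> 'I_n} | is_parking f && digraph_connected f]|.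

Local Open Scope ring_scope.
Local Open Scope classical_set_scope.

(** Meant for [v] eventually nonzero; division by zero being total, the other
    values of [u n / v n] do not affect the limit. *)
Definition asymp_equiv (R : realType) (u v : nat -> R) : Prop :=
  u n / v n @[n --> \oo] --> (1 : R).

(* Main.v *)
Require Import Defs.
From mathcomp Require Import all_boot all_order all_algebra.
From mathcomp Require Import zify ring lra.

(** With [N = n+1], the identity behind the theorem is
      [c(n) N = sum_(1 <= k < n) N(N-1)..(N-k+1) N^(n-k-1) + N!/n].
    Mark a vertex of the cycle of a connected [f], of length [k] say. The product
    of the [x (f v)] over all [v], summed over such pairs (each [f] occurring [k]
    times), is a sum over cycles read from a root, times a forest enumerator, and
    equals the enumerator of the words whose first [k] letters are distinct and whose next
    letter repeats one of them. Being a parking function depends only on the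
    multiset of values, so parking connected functions may be counted among
    these words. Over the larger alphabet Z/N they are closed under adding
    constants, and exactly one of the [N] translates of each is parking (Pollak).

    Asymptotically, [N(N-1)..(N-k+1) / N^k] is squeezed between values of the
    Gaussian [expR (- k^2 / (2 M))] with [M] equivalent to [N], so the sum of
    these ratios over [k] is equivalent to [sqrt (2 N)] times the integral of
    [expR (- x^2)] over the positive reals. *)

Set Implicit Arguments.
Unset Strict Implicit.
Unset Printing Implicit Defensive.

(** * The parking criterion *)

Section ParkingCriterion.
Variable n : nat.
Implicit Types (occ : {set 'I_n}) (p q s : 'I_n) (l : seq 'I_n) (f : {ffun 'I_n -> 'I_n}).

Lemma first_free_SomeP occ p s : first_free occ p = Some s ->
  [/\ p <= s, s \notin occ & forall q, p <= q < s -> q \in occ].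
Proof.
rewrite /first_free; set P := fun _ => _.
have srt : sorted (relpre (@nat_of_ord n) ltn) (enum 'I_n).
  by rewrite -sorted_map val_enum_ord iota_ltn_sorted.
have tr : transitive (relpre (@nat_of_ord n) ltn).
  by move=> a b c /=; exact: ltn_trans.
have := sorted_filter tr P srt.
case E : (filter P (enum 'I_n)) => [//|a t] /= pth [<-] {s}.
have : a \in filter P (enum 'I_n) by rewrite E mem_head.
rewrite mem_filter => /andP[/andP[pa aocc] _]; split => // q /andP[pq qa].
apply/negPn/negP => qocc.
have : q \in filter P (enum 'I_n) by rewrite mem_filter /P pq qocc mem_enum.
rewrite E inE => /orP[/eqP qE|qt]; first by rewrite qE ltnn in qa.
by have /allP/(_ q qt)/= := order_path_min tr pth; rewrite ltnNge (ltnW qa).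
Qed.

Lemma first_free_NoneP occ p q : first_free occ p = None -> p <= q -> q \in occ.
Proof.
rewrite /first_free; set P := fun _ => _.
case E : (filter P (enum 'I_n)) => [|//] _ pq; apply/negPn/negP => qocc.
have : q \in filter P (enum 'I_n) by rewrite mem_filter /P pq qocc mem_enum.
by rewrite E.
Qed.

Notation occupied l := (foldl (@park_car n) finset.set0 l).

(** No car parks before its preferred space, so each occupied space below [j] is owed to a
    preference below [j]. *)
Lemma card_occupied_lt l j :
  #|[set s in occupied l | s < j]| <= count (fun p => p < j) l.
Proof.
elim/last_ind: l => [|l p IH] /=.
  by rewrite (_ : [set s in _ | _] = finset.set0) ?cards0 //; apply/setP=> s; rewrite !inE.
rewrite foldl_rcons -cats1 count_cat /= addn0.
move: (foldl _ _ _) IH => occ IH; rewrite /park_car.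
case E : (first_free _ _) => [s|]; last by rewrite (leq_trans IH) ?leq_addr.
have [ps sNocc _] := first_free_SomeP E.
have [sj|sj] := ltnP s j.
  rewrite (_ : [set _ in _ | _] = s |: [set s in occ | s < j]); last first.
    by apply/setP=> q; rewrite !inE; case: eqP => [->|]; rewrite ?sj.
  rewrite cardsU1 addnC leq_add // (leq_ltn_trans ps sj); exact: leq_b1.
rewrite (_ : [set _ in _ | _] = [set s in occ | s < j]).
  by rewrite (leq_trans IH) ?leq_addr.
apply/setP=> q; rewrite !inE; case: eqP => [->|//].
by rewrite ltnNge sj /= andbF.
Qed.

(** No car has driven past a space that is still free, so every car parked beyond [q] also preferred
    a space beyond [q]. *)
Lemma card_occupied_gt l q : q \notin occupied l ->
  #|[set s in occupied l | q < s]| <= count (fun p : 'I_n => q < p) l.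
Proof.
elim/last_ind: l => [|l p IH] /=.
  by move=> _; rewrite (_ : [set s in _ | _] = finset.set0) ?cards0 //; apply/setP=> s; rewrite !inE.
rewrite foldl_rcons -cats1 count_cat /= addn0.
move: (foldl _ _ _) IH => occ IH; rewrite /park_car.
case E : (first_free _ _) => [s|]; last by move=> /IH H; rewrite (leq_trans H) ?leq_addr.
have [ps sNocc slt] := first_free_SomeP E.
rewrite !inE negb_or => /andP[qs qNocc]; have {}IH := IH qNocc.
have [qls|sq] := ltnP q s; last first.
  rewrite (_ : [set _ in _ | _] = [set s in occ | q < s]).
    by rewrite (leq_trans IH) ?leq_addr.
  apply/setP=> r; rewrite !inE; case: eqP => [->|//].
  by rewrite ltnNge sq /= andbF.
have qp : q < p.
  by rewrite ltnNge; apply: contra qNocc => pq; apply: slt; rewrite pq qls.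
rewrite (_ : [set _ in _ | _] = s |: [set s in occ | q < s]); last first.
  by apply/setP=> r; rewrite !inE; case: eqP => [->|]; rewrite ?qls.
by rewrite cardsU1 addnC qp leq_add // leq_b1.
Qed.

Let prefs f k := [seq f j | j : 'I_n <- enum 'I_n & j < k].

Let prefs_rcons f (i : 'I_n) : prefs f i.+1 = rcons (prefs f i) (f i).
Proof.
rewrite /prefs -map_rcons; congr (map f _).
have inj : injective (map (@nat_of_ord n)) by apply: inj_map; exact: val_inj.
apply: inj; rewrite map_rcons.
have H k : k <= n -> map (@nat_of_ord n) [seq j : 'I_n <- enum 'I_n | j < k] = iota 0 k.
  move=> kn; rewrite -(filter_map (@nat_of_ord n) (fun j => j < k)) val_enum_ord.
  rewrite -(subnKC kn) iotaD filter_cat -[RHS]cats0; congr (_ ++ _).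
    by apply/all_filterP/allP=> x; rewrite mem_iota.
  apply/eqP; rewrite -(negbK (_ == _)) -has_filter; apply/hasPn=> x.
  by rewrite mem_iota add0n -leqNgt => /andP[].
by rewrite !H ?(ltnW (ltn_ord i)) // -cats1 -addn1 iotaD.
Qed.

Let count_prefs f k (P : pred 'I_n) :
  count P (prefs f k) = #|[set j : 'I_n | (j < k) && P (f j)]|.
Proof.
rewrite count_map count_filter cardE -count_filter -size_filter -filter_predI.
rewrite enumT [X in _ = size X]/enum_mem.
by congr size; apply: eq_filter => j; rewrite /= !inE andbC.
Qed.

Lemma card_ord_ltn k : k <= n -> #|[set s : 'I_n | s < k]| = k.
Proof.
move=> kn; rewrite -sum1_card (eq_bigl (fun s : 'I_n => s < k)) => [|s]; last by rewrite inE.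
by rewrite -(big_ord_widen n (fun=> 1)) // sum1_card card_ord.
Qed.

(** If all cars park, every space is taken and [card_occupied_lt] gives the bounds. Conversely, when
    car [i] fails, the occupied block at the end of the street was filled by cars preferring it;
    counting car [i] too, this block is preferred once too often. *)
Lemma is_parkingP f :
  reflect (forall j, j <= n -> j <= #|[set i | f i < j]|) (is_parking f).
Proof.
apply: (iffP forallP) => [park j jn|H i].
  have card_occ k : k <= n -> #|occupied (prefs f k)| = k.
    elim: k => [_|k IH kn].
      rewrite /prefs (eq_filter (a2 := pred0)) ?filter_pred0 ?cards0 //.
    rewrite (prefs_rcons f (Ordinal kn)) foldl_rcons /park_car.
    have := park (Ordinal kn); rewrite /occupied_before -/(prefs f k).
    case E : first_free => [s|//] _.
    have [_ sN _] := first_free_SomeP E.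
    by rewrite cardsU1 sN IH // ltnW.
  have full : occupied (prefs f n) = [set: 'I_n].
    by apply/eqP; rewrite eqEcard finset.subsetT /= cardsT card_ord card_occ.
  have := card_occupied_lt (prefs f n) j; rewrite full count_prefs.
  rewrite (_ : [set j0 : 'I_n | _] = [set i | f i < j]); last first.
    by apply/setP=> i; rewrite !inE ltn_ord.
  apply: leq_trans; rewrite -[X in X <= _](card_ord_ltn jn).
  by apply/subset_leq_card/fintype.subsetP=> s; rewrite !inE.
case E : first_free => [//|]; exfalso.
set occ := occupied_before f i in E.
pose Q k := [forall q : 'I_n, (k <= q) ==> (q \in occ)].
have exQ : exists k, Q k.
  by exists (f i); apply/forallP=> q; apply/implyP; exact: first_free_NoneP E.
(* The block of occupied spaces at the end starts at [m]: either [m = 0] and all spaces are taken,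
   or space [m.-1] is free. *)
case: (ex_minnP exQ) => m Qm minm.
have mf : m <= f i.
  by apply: minm; apply/forallP=> q; apply/implyP; exact: first_free_NoneP E.
have mn : m <= n by rewrite (leq_trans mf) // ltnW.
have HQ q : m <= q -> q \in occ by move: Qm => /forallP/(_ q)/implyP.
have cardge : #|[set s : 'I_n | m <= s]| = n - m.
  rewrite (_ : [set _ | _] = ~: [set s : 'I_n | s < m]); last first.
    by apply/setP=> s; rewrite !inE -leqNgt.
  by rewrite cardsCs finset.setCK card_ord card_ord_ltn.
have early : n - m <= #|[set j : 'I_n | (j < i) && (m <= f j)]|.
  rewrite -cardge; case: (posnP m) => [m0|m0].
    have := card_occupied_lt (prefs f i) n; rewrite count_prefs m0 => H0.
    apply: leq_trans (leq_trans _ H0) _; apply: subset_leq_card.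
      by apply/fintype.subsetP=> s _; rewrite inE ltn_ord andbT HQ // m0.
    by apply/fintype.subsetP=> s; rewrite !inE => /andP[->].
  have m1n : m.-1 < n by rewrite prednK.
  have m1N : Ordinal m1n \notin occ.
    apply/negP => m1occ; have : m <= m.-1; last by rewrite leqNgt prednK // leqnn.
    apply: minm; apply/forallP=> q; apply/implyP.
    rewrite leq_eqVlt => /orP[/eqP E1|]; first by rewrite (_ : q = Ordinal m1n) //; apply: val_inj.
    by rewrite prednK //; exact: HQ.
  have := card_occupied_gt m1N; rewrite count_prefs /= prednK // => H0.
  apply: leq_trans (leq_trans _ H0) _; apply: subset_leq_card.
    by apply/fintype.subsetP=> s; rewrite !inE => ms; rewrite HQ.
  by apply/fintype.subsetP=> s; rewrite !inE.
have late : [set j : 'I_n | (j < i) && (m <= f j)] \subset [set j | m <= f j] :\ i.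
  by apply/fintype.subsetP=> j; rewrite !inE => /andP[ji ->]; rewrite andbT -val_eqE /= ltn_eqF.
have := leq_trans early (subset_leq_card late).
have := cardsD1 i [set j | m <= f j]; rewrite inE mf => cD.
have := H m mn; rewrite (_ : [set i0 | f i0 < m] = ~: [set j | m <= f j]); last first.
  by apply/setP=> s; rewrite !inE -ltnNge.
rewrite cardsCs finset.setCK card_ord.
have : #|[set j | m <= f j]| <= n by rewrite -[X in _ <= X]card_ord max_card.
rewrite cD; move: #|_| => c; lia.
Qed.

End ParkingCriterion.

(** * The cycle lemma *)

Section CycleLemma.
Import GRing.Theory.
Variable n : nat.
Implicit Types (l : seq 'I_n.+1) (a v : 'I_n.+1).

(** The criterion of [is_parkingP] for words over any alphabet. Taking [j] equal to the length
    forces all letters below the length. *)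
Definition parking_word (l : seq nat) := all (fun j => j <= count (gtn j) l) (iota 0 (size l).+1).

Definition rotate_word a l : seq nat := [seq val (v - a)%R | v <- l].

(** Since [inZp] reduces modulo [n.+1], letter counts are continued periodically. The number of
    letters below [j] in a translate is then a difference of two prefixes, even when the window
    wraps around. *)
Let prefix l m := \sum_(i < m) count_mem (inZp i : 'I_n.+1) l.

Let inZpD (a : 'I_n.+1) j : (inZp (a + j) = a + inZp j :> 'I_n.+1)%R.
Proof. by apply: val_inj; rewrite /= modnDmr. Qed.

Let prefixD l a j : j <= n.+1 ->
  prefix l (a + j) = prefix l a + count (gtn j) (rotate_word a l).
Proof.
elim: j => [_|j IH jn]; first by rewrite addn0 count_map (eq_count (a2 := pred0)) ?count_pred0 ?addn0.
rewrite addnS /prefix big_ord_recr /= -/(prefix l _) IH ?(ltnW jn) // -addnA; congr addn.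
have -> : count_mem (inZp (a + j)) l = count_mem j (rotate_word a l).
  rewrite count_map; apply: eq_count => v.
  rewrite -[LHS]/(v == inZp (a + j)) -[RHS]/(val (v - a)%R == j).
  by rewrite inZpD addrC -subr_eq -val_eqE /= (modn_small jn).
have disj : predI (gtn j) (pred1 j) =1 pred0.
  by move=> v /=; case: eqP => [->|]; rewrite ?ltnn ?andbF.
rewrite -count_predUI (eq_count disj) count_pred0 addn0.
by apply: eq_count => v /=; rewrite [RHS]ltnS [RHS]leq_eqVlt orbC.
Qed.

Let prefix_period l (a : 'I_n.+1) : prefix l (a + n.+1) = prefix l a + size l.
Proof.
rewrite prefixD // -(size_map (fun v => val (v - a)%R) l) -count_predT; congr addn.
by apply: eq_in_count => _ /mapP[v _ ->]; exact: (ltn_ord (v - a)%R).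
Qed.

(** The translate by [a] is parking iff [prefix l m - m] is at least its value at [a] for all [m]
    from [a] to [a + n]. Over a full period this function drops by exactly 1, so its first minimum
    qualifies, while two solutions [a < b] would make the value at [a + n.+1] at least that at
    [a]. *)
Lemma cycle_lemma l : size l = n -> \sum_a parking_word (rotate_word a l) = 1.
Proof.
move=> sl.
have pkP a : reflect (forall j, j <= n -> prefix l a + j <= prefix l (a + j))
    (parking_word (rotate_word a l)).
  apply: (iffP allP) => H j.
    move=> jn; rewrite prefixD ?(leqW jn) // leq_add2l; apply: H.
    by rewrite mem_iota /= add0n size_map sl.
  rewrite mem_iota add0n size_map sl /= ltnS => jn.
  by have := H j jn; rewrite prefixD ?(leqW jn) // leq_add2l.
(* [g] is [prefix l m - m] raised by [n.+1] to stay in [nat]. The key [n.+1 * g a + a] minimized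
   next orders lexicographically, by [g] and then by position. *)
pose g (a : 'I_n.+1) := prefix l a + (n.+1 - a).
(* The parking translate starts at the first minimum of [prefix l m - m]. *)
have [a _ amin] := @arg_minnP _ (ord0 : 'I_n.+1) xpredT (fun a => n.+1 * g a + a) isT.
have gmin b : g a <= g b by have := amin b isT; have := ltn_ord a; have := ltn_ord b; nia.
have gmin' (b : 'I_n.+1) : b < a -> g a < g b by have := amin b isT; nia.
have Pa : parking_word (rotate_word a l).
  apply/pkP => j jn; have an := ltn_ord a; have [ajn|] := ltnP (a + j) n.+1.
    by have := gmin (Ordinal ajn); rewrite /g /=; lia.
  move=> ajn; have H : a + j - n.+1 < n.+1 by lia.
  have H' : a + j - n.+1 < a by lia.
  have := gmin' (Ordinal H) H'; rewrite /g /=.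
  have := prefix_period l (Ordinal H); rewrite /= subnK // sl; lia.
rewrite (bigD1 a) //= Pa big1 // => b ba; case: (pkP b) => // Pb.
move/pkP: Pa => Pa; exfalso.
wlog ab : a b ba Pa Pb {amin gmin gmin'} / a < b.
  move=> W; have [ab|ab|E] := ltngtP a b; first exact: (W a b).
    by apply: (W b a) => //; rewrite eq_sym.
  by rewrite -val_eqE /= E eqxx in ba.
have bn := ltn_ord b.
have := Pa (b - a); rewrite subnKC ?(ltnW ab) //.
have := Pb (n.+1 + a - b); rewrite subnKC; last by lia.
rewrite [n.+1 + a]addnC prefix_period sl; lia.
Qed.

(** Count the pairs of a [t] and a translation making its word parking: each [t] has one by the
    cycle lemma, and each translation permutes the [t] satisfying [D]. *)
Lemma pollak (T : finType) (D : pred T) (w : T -> seq 'I_n.+1)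
    (shift : 'I_n.+1 -> T -> T) :
  (forall t, D t -> size (w t) = n) -> (forall a, injective (shift a)) ->
  (forall a t, D (shift a t) = D t) ->
  (forall a t, w (shift a t) = [seq (v - a)%R | v <- w t]) ->
  n.+1 * #|[set t | D t && parking_word (map val (w t))]| = #|[set t | D t]|.
Proof.
move=> sw shI Dsh wsh.
transitivity (\sum_(a : 'I_n.+1) \sum_(t | D t) parking_word (rotate_word a (w t))).
  transitivity (\sum_(a : 'I_n.+1) #|[set t | D t && parking_word (map val (w t))]|).
    by rewrite sum_nat_const card_ord.
  apply: eq_bigr => a _; rewrite cardsE -sum1_card big_mkcond.
  rewrite (reindex_inj (shI a)) /= [RHS]big_mkcond /=; apply: eq_bigr => t _.
  rewrite unfold_in /= Dsh wsh -map_comp.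
  by case: (D t) => //=; case: parking_word.
rewrite exchange_big /= cardsE -sum1_card; apply: eq_bigr => t Dt.
exact: cycle_lemma (sw t Dt).
Qed.

End CycleLemma.

(** * Forests with prescribed roots *)

Section ForestEnumerator.
Variable V : finType.
Implicit Types (f g h : {ffun V -> V}) (A C S U : {set V}) (u v w : V).

Definition reaches f C v := [exists w in C, fconnect f v w].

Lemma reachesP f C v : reflect (exists m, iter m f v \in C) (reaches f C v).
Proof.
apply: (iffP exists_inP) => [[w wC vw]|[m mC]].
  by exists (findex f v w); rewrite iter_findex.
by exists (iter m f v) => //; exact: fconnect_iter.
Qed.

(** The path up to the first visit of [S] uses only values off [S]. *)
Lemma reaches_eq_off f h S v : (forall w, w \notin S -> f w = h w) ->
  reaches f S v -> reaches h S v.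
Proof.
move=> fh /reachesP[m]; elim: m v => [|m IH] v mS.
  by apply/reachesP; exists 0.
have [vS|vS] := boolP (v \in S); first by apply/reachesP; exists 0.
rewrite iterSr fh // in mS; have /reachesP[k kS] := IH _ mS.
by apply/reachesP; exists k.+1; rewrite iterSr.
Qed.

(** The parent map of a forest on [U] rooted in [C]. Fixing all vertices outside [U] gives each
    forest exactly one encoding. *)
Definition forest C U f :=
  [&& [forall v, (v \notin U) ==> (f v == v)],
      [forall u in U, f u \in C :|: U] & [forall u in U, reaches f C u]].

Lemma forestP C U f :
  reflect [/\ forall v, v \notin U -> f v = v, forall u, u \in U -> f u \in C :|: U
            & forall u, u \in U -> reaches f C u] (forest C U f).
Proof.
apply: (iffP and3P) => -[].
  move=> /forallP H1 /forall_inP H2 /forall_inP H3; split=> //.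
  by move=> v vU; apply/eqP; exact: implyP (H1 v) vU.
move=> H1 H2 H3; split; [|exact/forall_inP|exact/forall_inP].
by apply/forallP=> v; apply/implyP=> /H1 ->.
Qed.

Local Notation bottom f C U := [set u in U | f u \in C].

(* A forest on [U] with roots in [C] is the set [S] of vertices sent into [C],
   a map [S -> C], and a forest on [U :\: S] with roots in [S]; both maps are
   padded with default values outside their domains. *)
Lemma forest_split v0 C U S f : S \subset U -> [disjoint C & U] ->
  (([ffun v => if v \in S then f v else v0] \in pffun_on v0 (mem S) (mem C)) &&
   forest S (U :\: S) [ffun v => if v \in S then v else f v]) =
  forest C U f && (bottom f C U == S).
Proof.
move=> /fintype.subsetP SU; rewrite disjoint_subset => /fintype.subsetP CU.
set g := [ffun v => _ ]; set h := [ffun v => _ ].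
have fh w : w \notin S -> h w = f w by move=> wS; rewrite ffunE (negbTE wS).
apply/andP/andP=> -[].
  move=> /pffun_onP[_ gC] /forestP[hU hS hr].
  have fC u : u \in S -> f u \in C.
    by move=> uS; have := gC (g u) (map_f _ _); rewrite mem_enum ffunE uS; exact.
  have fU u : u \in U -> u \notin S -> f u \in U.
    move=> uU uS; have := hS u; rewrite inE uU uS fh // => /(_ isT).
    by rewrite !inE; case: (boolP (f u \in S)) => [/SU|].
  split; last first.
    apply/eqP/setP=> u; rewrite !inE; have [uS|uS] := boolP (u \in S).
      by rewrite SU ?fC.
    by apply/negP=> /andP[uU /CU]; rewrite !inE fU.
  apply/forestP; split=> [v vU|u uU|u uU].
  - rewrite -fh; last by apply: contra vU; exact: SU.
    by apply: hU; rewrite inE (negbTE vU) andbF.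
  - by rewrite inE; have [/fC ->//|uS] := boolP (u \in S); rewrite fU ?orbT.
  - have : reaches f S u.
      have [uS|uS] := boolP (u \in S); first by apply/reachesP; exists 0.
      by apply: (reaches_eq_off fh); apply: hr; rewrite inE uS.
    by move=> /reachesP[m /fC mC]; apply/reachesP; exists m.+1.
move=> /forestP[f1 f2 f3] /eqP SE.
have fC u : u \in S -> f u \in C by rewrite -SE inE => /andP[].
have fU u : u \in U -> u \notin S -> f u \in U.
  move=> uU; rewrite -SE inE uU /= => fu; have := f2 u uU.
  by rewrite inE (negbTE fu).
split.
  apply/pffun_onP; split.
    by apply/fintype.subsetP=> v; rewrite inE ffunE; case: ifP => // _; rewrite eqxx.
  by move=> _ /imageP[u uS ->]; rewrite ffunE uS fC.
apply/forestP; split=> [v|u|u].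
- by rewrite inE negb_and negbK ffunE; case: ifP => //= _; exact: f1.
- by rewrite inE => /andP[uS uU]; rewrite fh // !inE (fU u) // andbT orbN.
rewrite inE => /andP[_ uU]; apply: (@reaches_eq_off f) => [w wS|]; first by rewrite fh.
have /reachesP[m] := f3 u uU; elim: m u uU => [|m IH] u uU.
  by move=> /CU; rewrite inE uU.
have [uS|uS] := boolP (u \in S); first by move=> _; apply/reachesP; exists 0.
rewrite iterSr => /(IH _ (fU u uU uS))/reachesP[k kS].
by apply/reachesP; exists k.+1; rewrite iterSr.
Qed.

Import GRing.Theory.
Local Open Scope ring_scope.
Variables (R : comNzRingType) (x : V -> R).
Local Notation xsum A := (\sum_(v in A) x v).

Let W C U : R := \sum_(f | forest C U f) \prod_(u in U) x (f u).

Let W_set0 C : W C finset.set0 = 1.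
Proof.
rewrite /W (big_pred1 [ffun v => v]) => [|f]; first by rewrite big_set0.
apply/forestP/eqP=> [[H _ _]|->].
  by apply/ffunP=> v; rewrite ffunE H ?inE.
by split=> v; rewrite ?inE ?ffunE.
Qed.

(** Forests are sorted by the set [S] of vertices attached directly to [C]; the maps from [S] to [C]
    contribute the power of [xsum C]. The vertex [v0] only pads these maps. *)
Let W_rec v0 C U : [disjoint C & U] ->
  W C U = \sum_(S : {set V} | S \subset U) xsum C ^+ #|S| * W S (U :\: S).
Proof.
move=> CU.
rewrite /W (partition_big (fun f => bottom f C U) (fun S : {set V} => S \subset U)) /=; last first.
  by move=> f _; apply/fintype.subsetP=> u; rewrite inE => /andP[].
apply: eq_bigr => S SU.
rewrite -prodr_const (big_distr_big v0) /= big_distrlr /= pair_big /=.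
pose split f := ([ffun v => if v \in S then f v else v0] : {ffun V -> V},
                 [ffun v => if v \in S then v else f v] : {ffun V -> V}).
pose glue (p : {ffun V -> V} * {ffun V -> V}) : {ffun V -> V} :=
  [ffun v => if v \in S then p.1 v else p.2 v].
rewrite [RHS](reindex_onto split glue) /=; last first.
  move=> [g h] /= /andP[/pffun_onP[gS _] /forestP[hS _ _]].
  congr pair; apply/ffunP=> v; rewrite !ffunE /=; have [vS|vS] := boolP (v \in S) => //.
    by have := fintype.subsetP gS v; rewrite !inE (negbTE vS); case: eqP => // _ /(_ isT).
  by rewrite hS // inE vS.
apply: eq_big => [f|f _].
  rewrite -(forest_split v0) // [glue _ == _](_ : _ = true) ?andbT //.
  by apply/eqP/ffunP=> v; rewrite !ffunE /=; case: ifP => // ->.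
rewrite (big_setID S) /= (finset.setIidPr SU); congr (_ * _); apply: eq_bigr => u.
  by move=> uS; rewrite ffunE uS.
by rewrite inE => /andP[/negbTE uS _]; rewrite ffunE uS.
Qed.

Lemma sum_subset_card (A : {set V}) (F : nat -> R) :
  \sum_(S : {set V} | S \subset A) F #|S| = \sum_(t < #|A|.+1) F t *+ 'C(#|A|, t).
Proof.
rewrite (partition_big (fun S : {set V} => inord #|S| : 'I_#|A|.+1) xpredT) //=.
apply: eq_bigr => t _; rewrite -cards_draws -sumr_const; apply: eq_big => [S|S].
  rewrite inE; apply: andb_id2l => SA.
  by rewrite -val_eqE /= inordK // ltnS subset_leq_card.
by move=> /andP[SA /eqP <-]; rewrite inordK // ltnS subset_leq_card.
Qed.

(** A weighted Cayley formula for rooted forests, by induction on the size of [U] through [W_rec];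
    the sum over [S] collapses by the binomial theorem. *)
Lemma forest_enumerator C U : [disjoint C & U] ->
  \sum_(f | forest C U f) \prod_(u in U) x (f u) =
  if U == finset.set0 then 1 else xsum C * xsum (C :|: U) ^+ #|U|.-1.
Proof.
rewrite -/(W C U); have [m] := ubnP #|U|; elim: m C U => // m IH C U Um CU.
have [->|U0] := eqVneq U finset.set0; first exact: W_set0.
have [v0 v0U] := set0Pn _ U0.
have Wempty : W finset.set0 U = 0.
  rewrite /W big_pred0 // => f; apply/forestP=> -[_ _ H].
  by have /reachesP[k] := H v0 v0U; rewrite inE.
rewrite (W_rec v0) //.
have -> : xsum (C :|: U) = xsum C + xsum U.
  by rewrite -bigU //; apply: eq_bigl => v; rewrite !inE.
set X := xsum C; set Y := xsum U.
(* The term [S = U] is split off as [X ^+ #|U|], hence the value 0 of [E] at [#|U|]. The empty [S]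
   drops out as an empty sum over [v]. *)
pose E t : R := if (t < #|U|)%N then X ^+ t * Y ^+ (#|U| - t).-1 else 0.
have step S : S \subset U -> X ^+ #|S| * W S (U :\: S) =
   (if S == U then X ^+ #|U| else 0) + \sum_(v in S) x v * E #|S|.
  move=> SU; have [->|SnU] := eqVneq S U.
    by rewrite finset.setDv W_set0 mulr1 -big_distrl /= /E ltnn mulr0 addr0.
  rewrite -big_distrl /= add0r.
  have [->|S0] := eqVneq S finset.set0; first by rewrite finset.setD0 Wempty big_set0 mul0r mulr0.
  have pSU : S \proper U by rewrite properEneq SnU.
  have cUS : #|U :\: S| = (#|U| - #|S|)%N by rewrite cardsD (finset.setIidPr SU).
  have SUS : S :|: (U :\: S) = U.
    by apply/setP=> v; rewrite !inE; case: (boolP (v \in S)) => // /(fintype.subsetP SU).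
  rewrite IH; last 2 first.
  - rewrite cUS; move: S0; rewrite -card_gt0; have := subset_leq_card SU; lia.
  - by rewrite -setI_eq0 finset.setIC finset.setDE -finset.setIA [_ :&: S]finset.setIC finset.setICr finset.setI0.
  rewrite finset.setD_eq0 -[U \subset S](_ : false = _); last first.
    by apply/esym/negP=> US; move: SnU; rewrite eqEsubset SU US.
  rewrite SUS -/Y cUS /E proper_card //; ring.
rewrite (eq_bigr _ step) big_split /= -big_mkcondr /= (big_pred1 U); last first.
  by move=> S; rewrite /=; case: eqP => [->|]; rewrite ?fintype.subxx ?andbF.
(* Choosing [v] before [S] leaves a free subset of [U :\ v], whence the binomials over [#|U|.-1]. *)
rewrite (exchange_big_dep (mem U)) /=; last by move=> S v /fintype.subsetP SU /SU.
have inner v : v \in U ->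
   \sum_(S : {set V} | (S \subset U) && (v \in S)) x v * E #|S| =
   x v * \sum_(t < #|U|.-1) E t.+1 *+ 'C(#|U|.-1, t).
  move=> vU; rewrite -big_distrr /=; congr (_ * _).
  have cUv : #|U :\ v| = #|U|.-1 by rewrite (cardsD1 v U) vU.
  have U1 : (0 < #|U|)%N by rewrite card_gt0.
  transitivity (\sum_(T : {set V} | T \subset U :\ v) E #|T|.+1).
    rewrite (reindex_onto (fun T => v |: T) (fun S => S :\ v)) /=; last first.
      by move=> S /andP[_ vS]; rewrite finset.setD1K.
    apply: eq_big => [T|T].
      rewrite setU11 andbT finset.subUset finset.sub1set vU subsetD1 /=; apply: andb_id2l => TU.
      have [vT|vT] := boolP (v \in T); last by rewrite setU1K ?eqxx.
      by apply/negP=> /eqP/setP/(_ v); rewrite !inE eqxx vT.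
    move=> /andP[_ /eqP TE]; rewrite cardsU1 -[in v \notin T]TE.
    by rewrite !inE eqxx.
  rewrite (sum_subset_card _ (fun t => E t.+1)) cUv big_ord_recr /=.
  by rewrite [E _.+1](_ : _ = 0) ?mul0rn ?addr0 // /E prednK // ltnn.
rewrite (eq_bigr _ inner) -big_distrl /= -/Y.
case EU : #|U| => [|u]; first by move/eqP: EU; rewrite cards_eq0 (negbTE U0).
rewrite /= [X + Y]addrC exprDn big_ord_recr /= subnn expr0 mul1r binn mulrDr.
rewrite exprS addrC; congr (_ + _); rewrite !big_distrr /=; apply: eq_bigr => t _.
rewrite /E EU ltnS ltn_ord subSS !mulrnAr; congr (_ *+ _).
have /prednK tu : (0 < u - t)%N by rewrite subn_gt0.
rewrite -[in RHS]tu !exprS; ring.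
Qed.

End ForestEnumerator.

(** * Connected functions and words *)

(* The first [k] letters are distinct and the next one, if any, repeats one of
   them. *)
Definition rho (T : eqType) k (s : seq T) :=
  uniq (take k s) && all (mem (take k s)) (take 1 (drop k s)).

Lemma rho_map (T T' : eqType) (h : T -> T') k s :
  injective h -> rho k (map h s) = rho k s.
Proof.
move=> hI; rewrite /rho -map_take -map_drop -map_take map_inj_uniq // all_map.
by congr andb; apply: eq_all => v /=; rewrite mem_map.
Qed.

Section RhoEnumerator.
Import GRing.Theory.
Local Open Scope ring_scope.
Variables (V : finType) (R : comNzRingType) (x : V -> R).

Lemma big_cons_tuple m (F : seq V -> R) :
  \sum_(w : m.+1.-tuple V) F w = \sum_c \sum_(w : m.-tuple V) F (c :: w).
Proof.
rewrite pair_big /= (reindex (fun p : V * m.-tuple V => [tuple of p.1 :: p.2])) //=.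
exists (fun w => (thead w, [tuple of behead w])) => [[c w]|w] _ /=.
  by congr pair; apply: val_inj.
by rewrite -tuple_eta.
Qed.

Lemma big_cat_tuple k m (F : seq V -> R) :
  \sum_(w : (k + m).-tuple V) F w = \sum_(u : k.-tuple V) \sum_(w : m.-tuple V) F (u ++ w).
Proof.
elim: k F => [|k IH] F.
  rewrite (big_pred1 [tuple]) => [|u]; first by [].
  by apply/esym/eqP/tuple0.
rewrite big_cons_tuple (big_cons_tuple _ (fun u => \sum_(w : m.-tuple V) F (u ++ w))).
by apply: eq_bigr => c _; rewrite (IH (fun s => F (c :: s))).
Qed.

Lemma sum_prod_tuple m : \sum_(w : m.-tuple V) \prod_(v <- w) x v = (\sum_v x v) ^+ m.
Proof.
elim: m => [|m IH].
  rewrite (big_pred1 [tuple]) ?big_nil ?expr0 // => u; exact/esym/eqP/tuple0.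
rewrite (big_cons_tuple m (fun w => \prod_(v <- w) x v)) exprS big_distrl /=; apply: eq_bigr => c _.
by rewrite -IH big_distrr /=; apply: eq_bigr => w _; rewrite big_cons.
Qed.

(** The distinct letters form [u], the next letter ranges over [u], and the remaining [m.-1] letters
    are free; for [m = 0] no repetition is required. *)
Lemma rho_enumerator k m :
  \sum_(w : (k + m).-tuple V | rho k w) \prod_(v <- w) x v =
  \sum_(u : k.-tuple V | uniq u) (\prod_(v <- u) x v) *
    (if m == 0%N then 1 else (\sum_(v <- u) x v) * (\sum_v x v) ^+ m.-1).
Proof.
rewrite big_mkcond (big_cat_tuple k m (fun w => if rho k w then \prod_(v <- w) x v else 0)) /=.
rewrite [RHS]big_mkcond; apply: eq_bigr => u _.
under eq_bigr => w _ do
  rewrite /rho take_size_cat ?size_tuple // drop_size_cat ?size_tuple //.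
have [uu|uu] /= := ifP; last by rewrite big1.
case: m => [|m].
  rewrite (big_pred1 [tuple]) => [|w]; last exact/esym/eqP/tuple0.
  by rewrite /= cats0 mulr1.
rewrite (big_cons_tuple m (fun w => if all (mem u) (take 1 w)
  then \prod_(v <- u ++ w) x v else 0)) /=.
have -> : \sum_(v <- u) x v = \sum_(v in u) x v by rewrite big_uniq.
rewrite -sum_prod_tuple big_distrl big_distrr /= [RHS]big_mkcond /=.
apply: eq_bigr => c _; under eq_bigr => w _ do rewrite take0 andbT.
case: ifP => cu; last by rewrite big1.
by rewrite !big_distrr /=; apply: eq_bigr => w _; rewrite big_cat big_cons.
Qed.

Implicit Types (f h : {ffun V -> V}) (r v : V).

(** Such an [r] is reached from [f r], so it lies on the only cycle, and [order f r] is the length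
    of that cycle. *)
Definition sink f r := [forall v, fconnect f v r].

Lemma fcycle_traject k (f : V -> V) (u : k.+1.-tuple V) :
  fcycle f u -> traject f (thead u) k.+1 = u.
Proof.
case/tupleP: u => r u; rewrite theadE /= => /fpathE.
rewrite size_rcons size_tuple trajectSr => /rcons_inj[<-].
by [].
Qed.

Lemma fcycle_next (f : V -> V) (u : seq V) :
  uniq u -> {in u, f =1 next u} -> fcycle f u.
Proof.
move=> uu fu; apply: (sub_in_cycle (P := mem u) _ _ (cycle_next uu)); last exact/allP.
by move=> v w vu _ /=; rewrite fu.
Qed.

(** A rooted connected function is a cycle read from its root with a forest attached, which
    [forest_enumerator] sums. The result is the right-hand side of [rho_enumerator]. *)
Lemma rooted_enumerator k m : #|V| = (k.+1 + m)%N ->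
  \sum_(p : {ffun V -> V} * V | sink p.1 p.2 && (order p.1 p.2 == k.+1)) \prod_v x (p.1 v) =
  \sum_(u : k.+1.-tuple V | uniq u) (\prod_(v <- u) x v) *
    (if m == 0%N then 1 else (\sum_(v <- u) x v) * (\sum_v x v) ^+ m.-1).
Proof.
move=> cV; pose C (u : seq V) := [set v in u].
(* [(f, r)] is encoded by the cycle read from [r], and by [f] made to fix the
   cycle pointwise. *)
pose split (p : {ffun V -> V} * V) : k.+1.-tuple V * {ffun V -> V} :=
  (Tuple (introT eqP (size_traject p.1 p.2 k.+1)),
   [ffun v => if v \in traject p.1 p.2 k.+1 then v else p.1 v]).
pose glue (q : k.+1.-tuple V * {ffun V -> V}) : {ffun V -> V} * V :=
  ([ffun v => if v \in q.1 then next q.1 v else q.2 v], thead q.1).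
transitivity (\sum_(u : k.+1.-tuple V | uniq u)
   \sum_(h : {ffun V -> V} | forest (C u) (~: C u) h)
     (\prod_(v <- u) x v) * \prod_(v in ~: C u) x (h v)); last first.
  apply: eq_bigr => u uu; rewrite -big_distrr /= forest_enumerator; last first.
    by rewrite -setI_eq0 finset.setICr.
  have cC : #|C u| = k.+1 by rewrite cardsE (card_uniqP uu) size_tuple.
  have cU : #|~: C u| = m by rewrite cardsCs finset.setCK cC cV addKn.
  rewrite -cards_eq0 cU finset.setUCr.
  have -> : \sum_(v in C u) x v = \sum_(v <- u) x v.
    by rewrite [RHS]big_uniq //=; apply: eq_bigl => v; rewrite !inE.
  by have -> : \sum_(v in [set: V]) x v = \sum_v x v by apply: eq_bigl => v; rewrite inE.
rewrite pair_big_dep /= [RHS](reindex_onto split glue) /=; last first.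
  move=> [u h] /= /andP[uu /forestP[hU _ _]].
  have hf v : v \in u -> (glue (u, h)).1 v = next u v by move=> vu; rewrite ffunE vu.
  have fu : fcycle (glue (u, h)).1 u.
    by apply: fcycle_next => // v vu; rewrite hf.
  have tu : traject (glue (u, h)).1 (glue (u, h)).2 k.+1 = u := fcycle_traject fu.
  congr pair; first by apply: val_inj.
  apply/ffunP=> v; rewrite [LHS]ffunE tu.
  case: ifP => vu; last by rewrite ffunE vu.
  by rewrite hU // !inE vu.
have fcyc f r : sink f r -> fcycle f (orbit f r).
  by move=> /forallP/(_ (f r)); apply: (all_iffLR orbitPcycle 2 0).
apply: eq_big => [[f r] /=|[f r] /= /andP[rs /eqP ro]].
  rewrite -[r :: _]/(traject f r k.+1); set t := traject f r k.+1.
  set h := [ffun v => if v \in t then v else f v].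
  have fh v : v \notin C t -> h v = f v by rewrite inE ffunE => /negbTE ->.
  rewrite -[(r \notin _) && _]/(uniq t).
  apply/andP/andP=> [[rs /eqP ro]|[/andP[ut /forestP[hU _ hr]] /eqP[/ffunP fE]]].
    have tE : t = orbit f r by rewrite /t /orbit ro.
    have ct : fcycle f t by rewrite tE fcyc.
    have ut : uniq t by rewrite tE orbit_uniq.
    rewrite ut; split; last first.
      apply/eqP; congr pair; apply/ffunP=> v; rewrite ffunE /=.
      rewrite -[r :: _]/t; case: ifP => vt; last by rewrite ffunE vt.
      by rewrite (eqP (next_cycle ct vt)).
    apply/forestP; split=> [v|v _|v _].
    - by rewrite finset.in_setC negbK finset.in_set ffunE => vt; rewrite /= vt.
    - by rewrite finset.setUCr inE.
    - apply: (@reaches_eq_off _ f) => [w wC|]; first by rewrite fh.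
      apply/exists_inP; exists r; last exact: (forallP rs).
      by rewrite inE mem_head.
  have ct : fcycle f t.
    by apply: fcycle_next => // v vt; rewrite -fE ffunE /= -[r :: _]/t vt.
  have rt : r \in t by rewrite mem_head.
  split; last by rewrite (order_cycle ct ut rt) size_traject.
  apply/forallP=> v.
  have /exists_inP[w wC vw] : reaches f (C t) v.
    have [vt|vt] := boolP (v \in C t); first by apply/reachesP; exists 0%N.
    by apply: (reaches_eq_off fh); apply: hr; rewrite inE.
  by apply: connect_trans vw _; rewrite (fconnect_cycle ct) //; rewrite inE in wC.
have ut : uniq (traject f r k.+1) by rewrite -ro orbit_uniq.
rewrite (bigID (mem (C (traject f r k.+1)))) /=; congr (_ * _).
  transitivity (\prod_(v <- traject f r k.+1) x (f v)).
    by rewrite [RHS]big_uniq //=; apply: eq_bigl => v; rewrite !inE.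
  (* Applying [f] rotates the cycle by one step, so the product of weights along it is unchanged. *)
  rewrite -(big_map f xpredT x) (_ : map f _ = traject f (f r) k.+1); last first.
    by elim: k.+1 r {rs ro ut} => //= i IH r; rewrite IH.
  have itr : iter k.+1 f r = r by rewrite -ro (iter_order_cycle (fcyc f r rs)) ?in_orbit.
  by rewrite trajectSr -cats1 -iterSr itr big_cat big_seq1 [RHS]big_cons [RHS]mulrC.
apply: eq_big => [v|v vN]; first by rewrite finset.in_setC.
have vt : v \notin traject f r k.+1 by move: vN; rewrite /= finset.in_set.
rewrite ffunE; case: ifP => // vt'; by rewrite -[_ \in _]/(v \in traject f r k.+1) (negbTE vt) in vt'.
Qed.

End RhoEnumerator.

(** * Equidistribution and the exact count *)

Lemma digits_inj D n (c c' : 'I_n -> nat) :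
  (forall i, c i < D) -> (forall i, c' i < D) ->
  \sum_i c i * D ^ i = \sum_i c' i * D ^ i -> c =1 c'.
Proof.
elim: n c c' => [c c' _ _ _ [] //|n IH c c' cD c'D].
rewrite !big_ord_recl /= !expn0 !muln1.
have shift (b : 'I_n.+1 -> nat) : \sum_(i < n) b (lift ord0 i) * D ^ bump 0 i =
    (\sum_(i < n) b (lift ord0 i) * D ^ i) * D.
  by rewrite big_distrl /=; apply: eq_bigr => i _; rewrite /bump add1n expnSr mulnA.
rewrite !shift => E; have D0 : 0 < D by rewrite (leq_ltn_trans _ (cD ord0)).
have E0 : c ord0 = c' ord0.
  by have := congr1 (modn^~ D) E; rewrite ![c _ + _]addnC ![c' _ + _]addnC !modnMDl !modn_small.
have {}E : \sum_(i < n) c (lift ord0 i) * D ^ i = \sum_(i < n) c' (lift ord0 i) * D ^ i.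
  by move: E; rewrite E0 => /addnI/eqP; rewrite eqn_pmul2r // => /eqP.
move=> i; case: (unliftP ord0 i) => [j|] -> //.
exact: (IH (fun j => c (lift ord0 j)) (fun j => c' (lift ord0 j))).
Qed.

Section Equidistribution.
Variables (d N : nat) (I J : finType) (A : pred I) (B : pred J).
Variables (w : I -> seq 'I_d) (w' : J -> seq 'I_d).
Hypothesis size_w : forall i, A i -> size (w i) = N.
Hypothesis size_w' : forall j, B j -> size (w' j) = N.
Hypothesis ww' : forall x : 'I_d -> {poly int},
  (\sum_(i | A i) \prod_(v <- w i) x v = \sum_(j | B j) \prod_(v <- w' j) x v)%R.

(* Evaluating at [x v = 'X^((N.+1)^v)] turns a word into the monomial whose
   exponent lists the letter multiplicities in base [N.+1]. *)
Let code (s : seq 'I_d) := \sum_(v <- s) N.+1 ^ v.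

Let code_perm s t : size s = N -> size t = N -> code s = code t -> perm_eq s t.
Proof.
have codeE r : code r = \sum_(i < d) count_mem i r * N.+1 ^ i.
  rewrite /code; elim: r => [|v r IH].
    by rewrite big_nil big1.
  rewrite big_cons IH; under [RHS]eq_bigr => i _ do rewrite /= mulnDl.
  rewrite big_split /= [X in _ = X + _](bigD1 v) //= eqxx mul1n [X in _ = _ + X + _]big1 ?addn0 // => i.
  by rewrite eq_sym => /negbTE ->.
move=> ss st; rewrite !codeE => E.
have H := digits_inj _ _ E.
apply/allP => v _; apply/eqP; apply: H => i.
  by rewrite ltnS -ss count_size.
by rewrite ltnS -st count_size.
Qed.

(** The two sides are the coefficients of ['X^m] in the two enumerators. *)
Let card_code m : #|[set i | A i && (code (w i) == m)]| = #|[set j | B j && (code (w' j) == m)]|.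
Proof.
pose x (v : 'I_d) : {poly int} := ('X^(N.+1 ^ v)%N)%R.
have H (K : finType) (C : pred K) (z : K -> seq 'I_d) :
    ((\sum_(k | C k) \prod_(v <- z k) x v)`_m = #|[set k | C k && (code (z k) == m)]|%:R)%R.
  rewrite coef_sum cardsE -sum1_card GRing.natr_sum [RHS]big_mkcondr /=.
  apply: eq_bigr => k _.
  have -> : (\prod_(v <- z k) x v = 'X^(code (z k)))%R.
    rewrite /code; elim: (z k) => [|v r IH]; first by rewrite !big_nil GRing.expr0.
    by rewrite !big_cons IH GRing.exprD.
  by rewrite coefXn eq_sym; case: eqP.
have := congr1 (fun p : {poly int} => p`_m)%R (ww' x).
by rewrite !H => /eqP; rewrite Num.Theory.eqr_nat => /eqP.
Qed.

(** By [code_perm], words with the same [code] are permutations of each other, so [P] is constant on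
    each class, and [card_code] makes the classes equally large on both sides. *)
Lemma equidistribution (P : pred (seq 'I_d)) :
  (forall s t, perm_eq s t -> P s = P t) ->
  #|[set i | A i && P (w i)]| = #|[set j | B j && P (w' j)]|.
Proof.
move=> Pperm.
pose M := (\max_i code (w i) + \max_j code (w' j)).+1.
have H (K : finType) (C : pred K) (z : K -> seq 'I_d) : (forall k, code (z k) < M) ->
    #|[set k | C k && P (z k)]| =
    \sum_(m < M) #|[set k | C k && (code (z k) == m) && P (z k)]|.
  move=> zM; rewrite cardsE -sum1_card (partition_big (fun k => Ordinal (zM k)) xpredT) //=.
  apply: eq_bigr => m _; rewrite cardsE -sum1_card; apply: eq_bigl => k.
  by rewrite ?inE -val_eqE /= andbAC.
have Mw i : code (w i) < M.
  by rewrite ltnS; apply: leq_trans (leq_addr _ _); exact: (@leq_bigmax _ (fun i => code (w i))).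
have Mw' j : code (w' j) < M.
  by rewrite ltnS; apply: leq_trans (leq_addl _ _); exact: (@leq_bigmax _ (fun j => code (w' j))).
rewrite (H _ _ _ Mw) (H _ _ _ Mw').
apply: eq_bigr => m _.
have const r : size r = N -> code r = m -> 
   (#|[set i | A i && (code (w i) == m) && P (w i)]| = P r * #|[set i | A i && (code (w i) == m)]|) /\
   (#|[set i | B i && (code (w' i) == m) && P (w' i)]| = P r * #|[set i | B i && (code (w' i) == m)]|).
  move=> sr cr; have aux (K : finType) (C : pred K) (z : K -> seq 'I_d) :
      (forall k, C k -> size (z k) = N) ->
      #|[set k | C k && (code (z k) == m) && P (z k)]| = P r * #|[set k | C k && (code (z k) == m)]|.
    move=> sz; rewrite (_ : [set k | _ && P _] =
      if P r then [set k | C k && (code (z k) == m)] else finset.set0).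
      by case: (P r); rewrite ?mul1n ?cards0.
    apply/setP=> k; rewrite inE; have [/andP[Ck /eqP ck]|nk] := boolP (C k && _).
      rewrite (Pperm (z k) r); last by apply: code_perm; rewrite ?sz ?ck.
      by case: ifP; rewrite inE ?Ck ?ck ?eqxx.
    by case: ifP; rewrite inE ?(negbTE nk).
  by split; apply: aux.
(* A word with code [m] serves as representative [r]; if there is none on the left, both counts
   vanish. *)
have [i /andP[Ai /eqP ci]|Am] := pickP [pred i | A i && (code (w i) == m)].
  by have [-> ->] := const _ (size_w Ai) ci; rewrite card_code.
have A0 : #|[set i | A i && (code (w i) == m)]| = 0.
  by apply: eq_card0 => i; rewrite inE; exact: Am.
have sub0 (K : finType) (C : pred K) (z : K -> seq 'I_d) :
   #|[set k | C k && (code (z k) == m)]| = 0 -> #|[set k | C k && (code (z k) == m) && P (z k)]| = 0.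
  move=> /eqP; rewrite cards_eq0 => /eqP/setP E; apply: eq_card0 => k.
  by have := E k; rewrite !inE => ->.
by rewrite !sub0 // -card_code.
Qed.

End Equidistribution.

Lemma parking_word_perm (s t : seq nat) : perm_eq s t -> parking_word s = parking_word t.
Proof.
move=> st; rewrite /parking_word (perm_size st); apply: eq_all => j.
by move/seq.permP: st => ->.
Qed.

Lemma is_parking_codom d (f : {ffun 'I_d -> 'I_d}) :
  is_parking f = parking_word (map val (codom f)).
Proof.
have cE j : count (gtn j) (map val (codom f)) = #|[set i | f i < j]|.
  rewrite -sum1_count big_map /codom /image_mem big_map big_enum_cond -sum1_card.
  by apply: eq_bigl => i; rewrite inE.
apply/is_parkingP/allP => H j.
  by rewrite mem_iota add0n size_map size_codom card_ord ltnS => /H; rewrite cE.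
move=> jd; have := H j; rewrite cE; apply.
by rewrite mem_iota add0n size_map size_codom card_ord ltnS.
Qed.

(** * Rooted parking functions with a given cycle length *)

Section CountRooted.
Variables k m : nat.
Let n := (k.+1 + m)%N.

Let R := [set p : {ffun 'I_n -> 'I_n} * 'I_n |
  (sink p.1 p.2 && (order p.1 p.2 == k.+1)) && is_parking p.1].

Let card_rooted :
  #|R| = #|[set w : n.-tuple 'I_n | rho k.+1 w && parking_word (map val w)]|.
Proof.
rewrite /R; under eq_finset => p do rewrite is_parking_codom.
apply: (@equidistribution n n _ _ (fun p : {ffun 'I_n -> 'I_n} * 'I_n => sink p.1 p.2 && (order p.1 p.2 == k.+1))
   (fun w : n.-tuple 'I_n => rho k.+1 w) (fun p => codom p.1) (@tval _ _) _ _ _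
   (fun s => parking_word (map val s))).
- by move=> p _; rewrite size_codom card_ord.
- by move=> w _; rewrite size_tuple.
- move=> x; rewrite rho_enumerator -(rooted_enumerator _ (card_ord n)).
  by apply: eq_bigr => p _; rewrite /codom /image_mem big_map big_enum.
- by move=> s t st; apply: parking_word_perm; rewrite perm_map.
Qed.

(** A parking word of length [n] never uses the letter [n], so the additional letter of the alphabet
    Z/(n+1) creates no new parking words. *)
Let card_widen :
  #|[set w : n.-tuple 'I_n | rho k.+1 w && parking_word (map val w)]| =
  #|[set w : n.-tuple 'I_n.+1 | rho k.+1 w && parking_word (map val w)]|.
Proof.
pose h (w : n.-tuple 'I_n) := map_tuple (widen_ord (leqnSn n)) w.
have wI : injective (widen_ord (leqnSn n)) by move=> u v /(congr1 val) /= E; apply: val_inj.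
have hI : injective h.
  by move=> u v /(congr1 val) /= E; apply: val_inj; exact: inj_map E.
rewrite -(card_imset _ hI); apply: eq_card => w; rewrite inE; apply/imsetP/andP.
  move=> [u]; rewrite inE => /andP[ru pu] ->; split; first by rewrite /= rho_map.
  by rewrite /= -map_comp; congr parking_word : pu; apply: eq_map.
move=> [rw pw]; have := allP pw n; rewrite mem_iota size_map size_tuple leqnn => /(_ isT) pn.
pose g (v : 'I_n.+1) : 'I_n := insubd (ord0 : 'I_(k + m).+1) (val v).
have wn : all (gtn n) (map val w).
  by rewrite all_count eqn_leq count_size size_map size_tuple.
have gK : map (widen_ord (leqnSn n)) (map g w) = w.
  rewrite -map_comp; apply: map_id_in => v vw; apply: val_inj => /=.
  by rewrite insubdK //; exact: (allP wn) (map_f _ vw).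
exists (map_tuple g w); last by apply: val_inj; rewrite /= gK.
rewrite inE /= -(rho_map _ _ wI) gK rw /=.
rewrite (_ : map val (map g w) = map val w) //.
by rewrite -[in RHS]gK -[RHS]map_comp; exact: eq_map.
Qed.

Lemma card_rho (V : finType) :
  #|[set w : n.-tuple V | rho k.+1 w]| =
  #|V| ^_ k.+1 * (if m == 0 then 1 else k.+1 * #|V| ^ m.-1).
Proof.
apply/eqP; rewrite -(Num.Theory.eqr_nat int) cardsE -GRing.sumr_const.
rewrite (eq_bigr (fun w : n.-tuple V => \prod_(v <- w) 1%R)%R) => [|w _]; last by rewrite big1_eq.
rewrite (rho_enumerator (fun=> 1%R)).
rewrite (eq_bigr (fun=> (if m == 0%N then 1%N else (k.+1 * #|V| ^ m.-1)%N)%:R)%R) => [|u uu];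
  last first.
  rewrite big1_eq GRing.mul1r; case: ifP => // _.
  rewrite GRing.sumr_const GRing.natrM GRing.natrX; congr (_ * _)%R.
  by rewrite big_const_seq count_predT size_tuple GRing.iter_addr_0.
rewrite GRing.sumr_const -GRing.mulrnA mulnC -(card_uniq_tuples k.+1 (@predT V)).
rewrite cardsE [X in _ == (X * _)%:R%R](_ : _ = #|[pred u : k.+1.-tuple V | uniq u]|) //.
apply: eq_card => u; by rewrite unfold_in /= all_predT inE.
Qed.

(** Adding a constant modulo [n.+1] keeps the pattern of repetitions, hence [rho], so [pollak]
    applies to the words counted by [card_rho]. *)
Lemma card_parking_rooted :
  n.+1 * #|R| = n.+1 ^_ k.+1 * (if m == 0 then 1 else k.+1 * n.+1 ^ m.-1).
Proof.
rewrite card_rooted card_widen -[in RHS](card_ord n.+1) -card_rho.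
pose shift (a : 'I_n.+1) (w : n.-tuple 'I_n.+1) := map_tuple (fun v => v - a)%R w.
have sI a : injective (fun v : 'I_n.+1 => v - a)%R by exact: GRing.addIr.
apply: (pollak (D := fun w : n.-tuple 'I_n.+1 => rho k.+1 w) (w := @tval _ _) (shift := shift)).
- by move=> w _; rewrite size_tuple.
- by move=> a u v /(congr1 val) /= E; apply: val_inj; exact: inj_map (sI a) _ _ E.
- by move=> a w; rewrite /= rho_map.
- by [].
Qed.

End CountRooted.

(** * From rooted functions to connected functions *)

Section CountConnected.
Import GRing.Theory Num.Theory.
Local Open Scope ring_scope.
Variable R : numFieldType.

Lemma card_sink (V : finType) (f : {ffun V -> V}) r : sink f r ->
  #|[set r' | sink f r']| = order f r.
Proof.
move=> /forallP sr; rewrite /order; apply: eq_card => r'; rewrite inE unfold_in.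
apply/forallP/idP => [H|rr' v]; first exact: H.
exact: connect_trans (sr v) rr'.
Qed.

(** Iterating [f] from any vertex reaches a cycle vertex [r]. The set of vertices that reach [r] is
    closed under adjacency in both directions, so it is everything when there is one component. *)
Lemma digraph_connectedP n (f : {ffun 'I_n -> 'I_n}) :
  reflect (exists r, sink f r) (digraph_connected f).
Proof.
have wsym : connect_sym (wadj f).
  by apply: sym_connect_sym => i j; rewrite /wadj /= orbC.
have conn_w i j : fconnect f i j -> connect (wadj f) i j.
  by apply: connect_sub => u v /eqP <-; apply: connect1; rewrite /wadj /= eqxx.
apply: (iffP eqP) => [cf|[r /forallP sr]]; last first.
  rewrite /n_comp_mem (eq_card (B := pred1 (fingraph.root (wadj f) r))) ?card1 // => v.
  rewrite !inE andbT; apply/eqP/eqP => [<-|->]; last exact: root_root.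
  by apply/esym/eqP; rewrite root_connect // wsym conn_w.
have [v0 _] : exists v0 : 'I_n, true.
  have /card_gt0P[v _] : (0 < n_comp (wadj f) [pred i : 'I_n | true])%N by rewrite cf.
  by exists v.
have /trajectP[i io cyc] := looping_order f v0.
pose r := iter i f v0.
have rr : fconnect f (f r) r.
  rewrite [X in fconnect f _ X](_ : r = iter (order f v0 - i.+1) f (f r)) ?fconnect_iter //.
  by rewrite /r -iterS -iterD subnK // cyc.
have fS u : fconnect f (f u) r = fconnect f u r.
  apply/idP/idP => [|ur]; first by apply: connect_trans; exact: fconnect1.
  have := iter_findex ur; case: findex => [|j] /=; first by move=> ->.
  by rewrite -iterS iterSr => <-; exact: fconnect_iter.
exists r; apply/forallP=> v.
have all_conn u w : connect (wadj f) u w.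
  rewrite -root_connect //; apply/eqP.
  have /card_le1_eqP H : (n_comp (wadj f) [pred i : 'I_n | true] <= 1)%N by rewrite cf.
  by apply: H; rewrite !inE roots_root.
have closed_r : closed (wadj f) [pred u | fconnect f u r].
  by move=> u w /orP[]/eqP <-; rewrite !inE fS.
by have := closed_connect closed_r (all_conn r v); rewrite !inE connect0 => <-.
Qed.

(* The sinks of a connected [f] are the vertices of its cycle, whose length is
   [order f r] for each of them. *)
Lemma sum_inv_order n (f : {ffun 'I_n -> 'I_n}) :
  \sum_(r | sink f r) (order f r)%:R^-1 = (digraph_connected f)%:R :> R.
Proof.
case: digraph_connectedP => [[r sr]|H]; last first.
  by rewrite big_pred0 // => r; apply/negP => sr; apply: H; exists r.
rewrite (eq_bigr (fun=> (order f r)%:R^-1)) => [|r' sr']; last by rewrite -!card_sink.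
rewrite sumr_const -cardsE (card_sink sr) -[_ *+ _]mulr_natr mulVf //.
by rewrite pnatr_eq0 -lt0n order_gt0.
Qed.

(** Weighting each root by the inverse cycle length counts every connected function once. This
    cancels the factor [k.+1] of [card_parking_rooted], except for [k.+1 = n], where that factor is
    absent and [n%:R^-1] remains. *)
Lemma connected_parking_count_sum n :
  (connected_parking_count n)%:R * n.+1%:R =
  \sum_(k < n) (n.+1 ^_ k.+1)%:R * (if k.+1 == n then n%:R^-1 else n.+1%:R ^+ (n - k.+1).-1) :> R.
Proof.
pose good (p : {ffun 'I_n -> 'I_n} * 'I_n) := sink p.1 p.2.
have -> : (connected_parking_count n)%:R =
    \sum_(k < n) #|[set p | (good p && (order p.1 p.2 == k.+1)) && is_parking p.1]|%:R / k.+1%:R :> R.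
  rewrite /connected_parking_count cardsE -sum1_card natr_sum.
  rewrite (eq_bigl (fun f => is_parking f && digraph_connected f)) => [|f]; last by rewrite unfold_in.
  rewrite big_mkcondr /=.
  transitivity (\sum_(f : {ffun 'I_n -> 'I_n} | is_parking f) \sum_(r | sink f r) ((order f r)%:R^-1 : R)).
    by apply: eq_bigr => f _; rewrite sum_inv_order; case: digraph_connected.
  rewrite pair_big_dep /=.
  have ordn (p : {ffun 'I_n -> 'I_n} * 'I_n) : ((order p.1 p.2).-1 < n)%N.
    by rewrite prednK ?order_gt0 // -[X in (_ <= X)%N]card_ord max_card.
  rewrite (partition_big (fun p => Ordinal (ordn p)) xpredT) //=; apply: eq_bigr => k _.
  have ordk (p : {ffun 'I_n -> 'I_n} * 'I_n) : (Ordinal (ordn p) == k) = (order p.1 p.2 == k.+1).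
    by rewrite -val_eqE /= -eqSS prednK // order_gt0.
  rewrite cardsE -sum1_card natr_sum big_distrl /=; apply: eq_big => [p|p].
    by rewrite unfold_in /= ordk -andbA andbC.
  by rewrite ordk mul1r => /andP[_ /eqP ->].
rewrite big_distrl /=; apply: eq_bigr => k _.
set P := [set p | _]; pose c := if (n - k.+1 == 0)%N then 1%N else (k.+1 * n.+1 ^ (n - k.+1).-1)%N.
have E : n.+1%:R * #|P|%:R = (n.+1 ^_ k.+1)%:R * c%:R :> R.
  by have := card_parking_rooted k (n - k.+1); rewrite subnKC // -!natrM -/P => ->.
rewrite mulrAC [_ * n.+1%:R]mulrC E -mulrA; congr (_ * _).
rewrite /c subn_eq0 [(n <= k.+1)%N](_ : _ = (k.+1 == n)); last by rewrite eqn_leq ltn_ord.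
case: eqP => [->|_]; first by rewrite mul1r.
by rewrite natrM natrX mulrAC divff ?mul1r // pnatr_eq0.
Qed.

End CountConnected.

From mathcomp Require Import boolp classical_sets functions reals topology.
From mathcomp Require Import normedtype sequences exp trigo.
From mathcomp Require Import ereal realfun measure lebesgue_measure.
From mathcomp Require Import lebesgue_integral ftc gauss_integral.
Import numFieldNormedType.Exports.

(** * Gaussian sums *)

Section GaussSums.
Import Order.TTheory GRing.Theory Num.Theory gauss_integral_proof.
Local Open Scope ring_scope.
Local Open Scope classical_set_scope.
Variable R : realType.
Implicit Types (a b h : R).
Local Notation G := (@integral0_gauss R).

Lemma integral0_gauss_cvg : G x @[x --> +oo] --> Num.sqrt pi / 2.
Proof.
have -> : Num.sqrt pi / 2 = Num.sqrt (pi / 4) :> R.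
  by rewrite sqrtrM ?pi_ge0 // sqrtrV // (_ : 4 = 2 ^+ 2) ?sqrtr_sqr ?ger0_norm // -natrX.
have -> : G = (fun x => Num.sqrt (G x ^+ 2)).
  by apply/funext => x; rewrite sqrtr_sqr ger0_norm // integral0_gauss_ge0.
apply: continuous_cvg; first exact: sqrt_continuous.
exact: cvg_integral0_gauss_sqr.
Qed.

(** The Gaussian decreases on the nonnegative reals, so its integral lies between two rectangles. *)
Lemma integral0_gaussB a b : 0 <= a -> a <= b ->
  (b - a) * gauss_fun b <= G b - G a <= (b - a) * gauss_fun a.
Proof.
move=> a0 ab.
have gint (i : interval R) : (@lebesgue_measure R).-integrable [set` i] (EFin \o gauss_fun).
  by apply: integrableS (@integrableT_gauss R).
rewrite /integral0_gauss Rintegral_itvB ?bnd_simp //.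
have mE : fine (@lebesgue_measure R `]a, b]) = b - a.
  rewrite lebesgue_measure_itv /= lte_fin.
  by have [_|ba|->] := ltgtP a b; rewrite ?subrr //; move: ab; rewrite leNgt ba.
have cst_int r : (@lebesgue_measure R).-integrable `]a, b] (EFin \o cst r).
  apply: (@integrableS _ _ R (@lebesgue_measure R) `[a, b]%classic) => //.
    by move=> x; rewrite /= !in_itv /= => /andP[/ltW -> ->].
  apply: continuous_compact_integrable; first exact: segment_compact.
  by move=> x; exact: cvg_cst.
rewrite ![(b - a) * _]mulrC -mE -!(Rintegral_cst lebesgue_measure) //.
have sqr_le x y : 0 <= x -> x <= y -> gauss_fun y <= gauss_fun x.
  by move=> x0 xy; rewrite /gauss_fun ler_expR lerN2 ler_sqr ?nnegrE // (le_trans x0).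
apply/andP; split.
  apply: le_Rintegral; [by []|exact: cst_int|exact: gint|].
  by move=> x; rewrite /= in_itv /= => /andP[ax xb]; rewrite sqr_le // (le_trans a0) // ltW.
apply: le_Rintegral; [by []|exact: gint|exact: cst_int|].
by move=> x; rewrite /= in_itv /= => /andP[ax xb]; rewrite sqr_le // ltW.
Qed.

Lemma integral0_gauss_le a b : 0 <= a -> a <= b -> G a <= G b.
Proof.
move=> a0 ab; rewrite -subr_ge0; have /andP[+ _] := integral0_gaussB a0 ab.
by apply: le_trans; rewrite mulr_ge0 ?gauss_fun_ge0 ?subr_ge0.
Qed.

Lemma integral0_gauss_ub a : 0 <= a -> G a <= Num.sqrt pi / 2.
Proof.
move=> a0; rewrite -(cvg_lim _ integral0_gauss_cvg) //.
apply: limr_ge; first by apply: cvgP integral0_gauss_cvg.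
near=> x; apply: integral0_gauss_le => //; near: x; exact: nbhs_pinfty_ge.
Unshelve. all: by end_near. Qed.

(** A right-endpoint Riemann sum lies below the integral; the term [k = 0] costs the additional
    [h]. *)
Lemma gauss_sum_le h m : 0 < h ->
  h * \sum_(k < m) gauss_fun (h * k%:R) <= h + Num.sqrt pi / 2.
Proof.
move=> h0; case: m => [|m].
  by rewrite big_ord0 mulr0 addr_ge0 ?divr_ge0 ?sqrtr_ge0 // ltW.
apply: (@le_trans _ _ (h + G (h * m%:R))); last first.
  by rewrite lerD2l integral0_gauss_ub // mulr_ge0 // ltW.
elim: m => [|m IH].
  rewrite big_ord1 !mulr0 /gauss_fun expr0n /= oppr0 expR0 mulr1 lerDl.
  exact: integral0_gauss_ge0.
rewrite big_ord_recr /= mulrDr.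
have /andP[+ _] : (h * m.+1%:R - h * m%:R) * gauss_fun (h * m.+1%:R) <=
    G (h * m.+1%:R) - G (h * m%:R) <= (h * m.+1%:R - h * m%:R) * gauss_fun (h * m%:R).
  by apply: integral0_gaussB; rewrite ?mulr_ge0 ?ler_pM2l ?ler_nat // ltW.
rewrite -mulrBr -natrB // subSnn mulr1; move: IH; lra.
Qed.

Lemma gauss_sum_ge h m : 0 < h -> G (h * m%:R) <= h * \sum_(k < m) gauss_fun (h * k%:R).
Proof.
move=> h0; elim: m => [|m IH].
  by rewrite big_ord0 !mulr0 /integral0_gauss set_itv1 Rintegral_set1.
rewrite big_ord_recr /= mulrDr.
have /andP[_] : (h * m.+1%:R - h * m%:R) * gauss_fun (h * m.+1%:R) <=
    G (h * m.+1%:R) - G (h * m%:R) <= (h * m.+1%:R - h * m%:R) * gauss_fun (h * m%:R).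
  by apply: integral0_gaussB; rewrite ?mulr_ge0 ?ler_pM2l ?ler_nat // ltW.
rewrite -mulrBr -natrB // subSnn mulr1; move: IH; lra.
Qed.

End GaussSums.

(** * Asymptotics *)

Import Order.TTheory GRing.Theory Num.Theory.

Section Asymptotics.
Import gauss_integral_proof.
Local Open Scope ring_scope.
Local Open Scope classical_set_scope.
Variable R : realType.
Local Notation G := (@integral0_gauss R).

(** For positive [N], the birthday probability that [k] uniform draws among [N] values are
    distinct. *)
Definition ffact_ratio (N k : nat) : R := (N ^_ k)%:R / N%:R ^+ k.

Lemma ffact_ratioS N k : ffact_ratio N k.+1 = ffact_ratio N k * ((N - k)%:R / N%:R).
Proof. by rewrite /ffact_ratio ffactnSr natrM exprSr invfM mulrACA. Qed.

Lemma ffact_ratio_ge0 N k : 0 <= ffact_ratio N k.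
Proof. by rewrite divr_ge0 ?exprn_ge0 ?ler0n. Qed.

Let inv_sqrt2 (N : nat) : R := (Num.sqrt (2 * N%:R))^-1.

Let gauss_inv_sqrt2 N k : gauss_fun (inv_sqrt2 N * k%:R) = expR (- (k%:R ^+ 2 / (2 * N%:R))).
Proof.
by rewrite /gauss_fun exprMn exprVn sqr_sqrtr ?mulr_ge0 ?ler0n // mulrC.
Qed.

(** Each factor [1 - i/N] is at most [expR (- i/N)], and the [i] up to [k] add up to [k(k+1)/2],
    which is at least [k^2/2]. *)
Lemma ffact_ratio_le N k : (0 < N)%N -> ffact_ratio N k.+1 <= gauss_fun (inv_sqrt2 N * k%:R).
Proof.
move=> N0; rewrite gauss_inv_sqrt2; have N0' : 0 < N%:R :> R by rewrite ltr0n.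
apply: (@le_trans _ _ (expR (- (k%:R * k.+1%:R / (2 * N%:R))))); last first.
  rewrite ler_expR lerN2 ler_pM2r ?invr_gt0 ?mulr_gt0 // expr2.
  by rewrite ler_wpM2l ?ler0n // ler_nat.
elim: k => [|k IH].
  by rewrite /ffact_ratio ffactn1 expr1 mul0r mul0r oppr0 expR0 divff // gt_eqF.
rewrite ffact_ratioS.
have -> : - (k.+1%:R * k.+2%:R / (2 * N%:R)) =
    - (k%:R * k.+1%:R / (2 * N%:R)) - k.+1%:R / N%:R :> R.
  by rewrite -!natr1; field; rewrite gt_eqF.
rewrite expRD ler_pM ?ffact_ratio_ge0 ?divr_ge0 ?ler0n //.
have [kN|Nk] := leqP k.+1 N.
  by apply: le_trans (expR_ge1Dx _); rewrite natrB // mulrBl divff ?gt_eqF.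
by rewrite (_ : (N - k.+1)%N = 0%N) ?mul0r ?expR_ge0 //; apply/eqP; rewrite subn_eq0 ltnW.
Qed.

(** The inverse factor [N/(N-i) = 1 + i/(N-i)] is at most [expR (i/(N-K))] for [i <= K], and the [i]
    below [k] add up to at most [k^2/2]. *)
Lemma ffact_ratio_ge N K k : (k <= K < N)%N ->
  gauss_fun (inv_sqrt2 (N - K) * k%:R) <= ffact_ratio N k.
Proof.
move=> /andP[kK KN]; rewrite gauss_inv_sqrt2.
have N0 : 0 < N%:R :> R by rewrite ltr0n (leq_ltn_trans _ KN).
have M0 : 0 < (N - K)%:R :> R by rewrite ltr0n subn_gt0.
elim: k kK => [_|k IH kK].
  by rewrite /ffact_ratio ffactn0 expr0 expr0n /= mul0r oppr0 expR0 divr1.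
have kN : (k < N)%N := ltn_trans kK KN.
rewrite ffact_ratioS.
apply: (@le_trans _ _ (expR (- (k%:R ^+ 2 / (2 * (N - K)%:R))) * expR (- (k%:R / (N - K)%:R)))).
  rewrite -expRD ler_expR -opprD lerN2.
  rewrite (_ : _ + _ = (k%:R ^+ 2 + 2 * k%:R) / (2 * (N - K)%:R)); last by field; rewrite gt_eqF.
  rewrite ler_pM2r ?invr_gt0 ?mulr_gt0 // -natr1; lra.
rewrite ler_pM ?expR_ge0 // ?IH ?(ltnW kK) //.
have Nk0 : 0 < (N - k)%:R :> R by rewrite ltr0n subn_gt0.
rewrite expRN invf_ple ?posrE ?expR_gt0 ?divr_gt0 // invf_div.
apply: le_trans (expR_ge1Dx _).
rewrite (_ : N%:R / (N - k)%:R = 1 + k%:R / (N - k)%:R); last first.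
  by rewrite -{1}(subnK (ltnW kN)) natrD mulrDl divff ?gt_eqF.
by rewrite lerD2l ler_wpM2l ?ler0n // lef_pV2 ?posrE // ler_nat leq_sub2l // ltnW.
Qed.

Let u n : R := (connected_parking_count n)%:R / n.+1%:R ^+ n.-1.

(** The term [k.+1 = n] of the exact count yields [N/n = 1 + 1/n] times its ratio, with [N = n.+1];
    the part [1/n] is the separate summand. *)
Lemma connected_ratio n : (0 < n)%N ->
  n.+1%:R * u n = \sum_(k < n) ffact_ratio n.+1 k.+1 + ffact_ratio n.+1 n / n%:R.
Proof.
case: n => // n _; rewrite /u mulrC mulrAC connected_parking_count_sum.
have N0 : n.+2%:R != 0 :> R by rewrite pnatr_eq0.
rewrite big_distrl /= big_ord_recr /= [in RHS]big_ord_recr /= -addrA; congr (_ + _).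
  apply: eq_bigr => k _; rewrite eqSS ltn_eqF // subSS.
  rewrite -mulrA; congr (_ * _).
  have E : n = (k.+1 + (n - k).-1)%N by have := ltn_ord k; lia.
  move: n.+2%:R N0 => x x0; rewrite [in X in _ / X]E exprD invfM mulrCA divff ?mulr1 //.
  by rewrite expf_neq0.
rewrite eqxx /ffact_ratio -mulrA -mulrA -mulrDr; congr (_ * _).
rewrite [in RHS]exprS; field.
by rewrite expf_neq0 // !nat1r -natrD !pnatr_eq0.
Qed.

Let L : R := Num.sqrt pi / 2.

Let L_gt0 : 0 < L. Proof. by rewrite divr_gt0 // sqrtr_gt0 pi_gt0. Qed.

(** The constant 2 covers the term [k = 0] of the Gaussian sum and the separate summand, each at
    most 1. *)
Lemma connected_ratio_le n : (0 < n)%N -> n.+1%:R * u n <= 2 + L * Num.sqrt (2 * n.+1%:R).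
Proof.
move=> n0; rewrite connected_ratio //.
have h0 : 0 < inv_sqrt2 n.+1 by rewrite invr_gt0 sqrtr_gt0 mulr_gt0.
have : \sum_(k < n) ffact_ratio n.+1 k.+1 <= 1 + L * Num.sqrt (2 * n.+1%:R).
  apply: (@le_trans _ _ (\sum_(k < n) gauss_fun (inv_sqrt2 n.+1 * k%:R))).
    by apply: ler_sum => k _; exact: ffact_ratio_le.
  rewrite -(ler_pM2l h0) (le_trans (gauss_sum_le n h0)) // mulrDr mulr1 lerD2l.
  by rewrite mulrCA mulVf ?mulr1 // gt_eqF // -invr_gt0.
have : ffact_ratio n.+1 n / n%:R <= 1.
  rewrite ler_pdivrMr ?ltr0n // mul1r (@le_trans _ _ 1) ?ler1n //.
  case: n n0 {h0} => // n _; apply: le_trans (ffact_ratio_le _ _) _ => //.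
  exact: gauss_fun_le1.
lra.
Qed.

(** Only the first [K] terms are kept, where [ffact_ratio_ge] applies; the [- 1] removes the term
    [k = 0] of the Gaussian sum. *)
Lemma connected_ratio_ge n K : (0 < n)%N -> (0 < K <= n)%N ->
  G (inv_sqrt2 (n.+1 - K) * K%:R) * Num.sqrt (2 * (n.+1 - K)%:R) - 1 <= n.+1%:R * u n.
Proof.
move=> n0 /andP[K0 Kn]; rewrite connected_ratio //.
have M0 : 0 < (n.+1 - K)%:R :> R by rewrite ltr0n subn_gt0.
have h0 : 0 < inv_sqrt2 (n.+1 - K) by rewrite invr_gt0 sqrtr_gt0 mulr_gt0.
apply: (@le_trans _ _ (\sum_(k < K) ffact_ratio n.+1 k.+1)); last first.
  rewrite ler_wpDr ?divr_ge0 ?ffact_ratio_ge0 //.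
  rewrite -(big_mkord xpredT (fun k => ffact_ratio n.+1 k.+1)).
  rewrite -(big_mkord xpredT (fun k => ffact_ratio n.+1 k.+1)) /=.
  rewrite [leRHS](big_cat_nat (n := K)) //= lerDl sumr_ge0 // => k _; exact: ffact_ratio_ge0.
apply: (@le_trans _ _ (\sum_(k < K.+1) gauss_fun (inv_sqrt2 (n.+1 - K) * k%:R) - 1)).
  rewrite lerD2r -(ler_pM2l h0) mulrCA mulVf ?mulr1; last by rewrite gt_eqF // -invr_gt0.
  apply: le_trans (gauss_sum_ge K.+1 h0).
  by apply: integral0_gauss_le; rewrite ?mulr_ge0 ?ler_pM2l ?ler_nat // ltW.
rewrite big_ord_recl /= mulr0 /gauss_fun expr0n oppr0 expR0 addrAC subrr add0r.
apply: ler_sum => k _; rewrite -[expR _]/(gauss_fun _) /bump add1n.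
by apply: ffact_ratio_ge; rewrite ltn_ord ltnS.
Qed.

(** The fourth root of [n.+1], in which all error terms are measured. *)
Let t n : R := Num.sqrt (Num.sqrt n.+1%:R).

Let t4 n : t n ^+ 4 = n.+1%:R.
Proof. by rewrite /t (exprM _ 2 2) !sqr_sqrtr ?sqrtr_ge0 ?ler0n. Qed.

Let t_ge1 n : 1 <= t n.
Proof. by rewrite /t -[leLHS]sqrtr1 ler_sqrt // -[leLHS]sqrtr1 ler_sqrt // ler1n. Qed.

Let t_cvg : t n @[n --> \oo] --> +oo.
Proof.
apply/cvgryPge => A; near=> n.
have [A0|A0] := leP A 0; first by rewrite (le_trans A0) // sqrtr_ge0.
rewrite -(@ler_pXn2r _ 4) ?nnegrE ?sqrtr_ge0 ?(ltW A0) // t4.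
apply: (@le_trans _ _ n%:R); last by rewrite ler_nat.
near: n; exact: nbhs_infty_ger.
Unshelve. all: by end_near. Qed.

Let ratio n := u n / Num.sqrt (pi / (2 * n%:R)).

Let ratioE n : (0 < n)%N ->
  ratio n = n.+1%:R * u n * Num.sqrt (2 * n%:R) / (L * (2 * n.+1%:R)).
Proof.
move=> n0; have n0' : 0 < n%:R :> R by rewrite ltr0n.
have -> : ratio n = u n / (Num.sqrt pi / Num.sqrt (2 * n%:R)).
  by rewrite /ratio (@sqrtrM _ pi) ?pi_ge0 // sqrtrV // mulr_ge0.
have s0 : 0 < Num.sqrt (2 * n%:R) :> R by rewrite sqrtr_gt0 mulr_gt0.
have p0 : 0 < Num.sqrt pi :> R by rewrite sqrtr_gt0 pi_gt0.
rewrite /L; field; by rewrite ?gt_eqF //= nat1r pnatr_eq0.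
Qed.

Let s n : R := Num.sqrt (2 * n.+1%:R).

Let s_ge n : t n <= s n.
Proof.
rewrite /t /s ler_sqrt ?mulr_ge0 // -[leRHS]sqr_sqrtr ?mulr_ge0 //.
have : 1 <= Num.sqrt (2 * n.+1%:R) :> R.
  by rewrite -[leLHS]sqrtr1 ler_sqrt ?mulr_ge0 // -natrM ler1n.
have : Num.sqrt n.+1%:R <= Num.sqrt (2 * n.+1%:R) :> R.
  by rewrite ler_sqrt ?mulr_ge0 // -natrM ler_nat leq_pmull.
nra.
Qed.

Lemma ratio_le n : (0 < n)%N -> ratio n <= 1 + 2 / (L * t n).
Proof.
move=> n0; rewrite ratioE //.
have t0 : 0 < t n by apply: lt_le_trans (t_ge1 n).
have s0 : 0 < s n by apply: lt_le_trans (s_ge n).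
have s2 : s n ^+ 2 = 2 * n.+1%:R by rewrite sqr_sqrtr ?mulr_ge0.
have u0 : 0 <= n.+1%:R * u n by rewrite mulr_ge0 ?divr_ge0 ?exprn_ge0.
have D0 : 0 < L * (2 * n.+1%:R) by rewrite mulr_gt0 ?L_gt0 ?mulr_gt0.
apply: (@le_trans _ _ ((2 + L * s n) * s n / (L * s n ^+ 2))).
  rewrite s2 ler_pM2r ?invr_gt0 //; apply: ler_pM (connected_ratio_le n0) _ => //.
  by rewrite /s ler_sqrt ?mulr_ge0 // ler_pM2l // ler_nat.
rewrite [leLHS](_ : _ = 1 + 2 / (L * s n)); last by field; rewrite !gt_eqF.
rewrite lerD2l ler_pM2l // lef_pV2 ?posrE; first by rewrite ler_pM2l ?L_gt0 ?s_ge.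
  exact: mulr_gt0 L_gt0 s0.
exact: mulr_gt0 L_gt0 t0.
Qed.

Lemma ratio_ge n : (0 < n)%N -> 2 <= t n ->
  (1 - (t n)^-1) * G ((t n - 1) / 2) / L - (L * t n)^-1 <= ratio n.
Proof.
move=> n0 t2; rewrite ratioE //.
have t0 : 0 < t n by apply: lt_le_trans (t_ge1 n).
have s0 : 0 < s n by apply: lt_le_trans (s_ge n).
have s2 : s n ^+ 2 = 2 * n.+1%:R by rewrite sqr_sqrtr ?mulr_ge0.
have D0 : 0 < L * (2 * n.+1%:R) by rewrite mulr_gt0 ?L_gt0 ?mulr_gt0.
(* [K] must be negligible before [N] but not before its square root; with
   [t n ^+ 4 = N] we take the integer part of [t n ^+ 3]. *)
have [K /andP[Kle Kgt]] : exists K : nat, K%:R <= t n ^+ 3 < K.+1%:R.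
  exists (Num.truncn (t n ^+ 3)); apply: truncn_itv; exact: exprn_ge0 (ltW t0).
have K0 : (0 < K)%N.
  by rewrite lt0n; apply/negP => /eqP K0; move: Kgt; rewrite K0; move: t2; nra.
have t3n : t n ^+ 3 < n.+1%:R by rewrite -(t4 n); move: t2; rewrite exprSr; nra.
have Kn : (K <= n)%N by rewrite -ltnS -(ltr_nat R) (le_lt_trans Kle).
pose M : R := (n.+1 - K)%:R.
have ME : M = n.+1%:R - K%:R by rewrite /M natrB // leqW.
have M0 : 0 < M by rewrite ltr0n subn_gt0.
pose m := Num.sqrt (2 * M).
have m0 : 0 < m by rewrite sqrtr_gt0 mulr_gt0.
have m2 : m ^+ 2 = 2 * M by rewrite sqr_sqrtr // mulr_ge0 // ltW.
pose r : R := Num.sqrt (2 * n%:R).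
have mr : m <= r by rewrite ler_sqrt ?mulr_ge0 // ler_pM2l // ler_nat; lia.
have rs : r <= s n by rewrite ler_sqrt ?mulr_ge0 // ler_pM2l // ler_nat.
have lower := connected_ratio_ge n0 (introT andP (conj K0 Kn)).
rewrite -/M -/m in lower.
set g := G _ in lower.
(* The argument of [G] in [g] is [K / m], with [K > t^3 - 1] and [m <= 2 t^2]. *)
have g_ge : G ((t n - 1) / 2) <= g.
  apply: integral0_gauss_le; first by rewrite divr_ge0 // subr_ge0.
  rewrite /inv_sqrt2 -/M -/m [leRHS]mulrC ler_pdivlMr //.
  have s_le : s n <= 2 * t n ^+ 2.
    rewrite -(@ler_pXn2r _ 2) ?nnegrE ?(ltW s0) ?mulr_ge0 ?exprn_ge0 ?(ltW t0) // s2 -(t4 n).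
    by have := exprn_ge0 4 (ltW t0); lra.
  apply: (@le_trans _ _ ((t n - 1) / 2 * (2 * t n ^+ 2))).
    by rewrite ler_wpM2l ?divr_ge0 ?subr_ge0 // (le_trans mr) // (le_trans rs).
  move: Kgt; rewrite -natr1; move: t2; nra.
have g0 : 0 <= G ((t n - 1) / 2) by exact: integral0_gauss_ge0.
apply: (@le_trans _ _ ((g * m ^+ 2 - s n) / (L * s n ^+ 2))); last first.
  rewrite s2 ler_pM2r ?invr_gt0 // -/r.
  have gm : g * m * m <= g * m * r.
    by rewrite ler_wpM2l // mulr_ge0 ?(ltW m0) // (le_trans g0).
  have lr : (g * m - 1) * r <= n.+1%:R * u n * r by rewrite ler_wpM2r ?sqrtr_ge0.
  by apply: le_trans lr; rewrite mulrBl mul1r lerB // expr2 mulrA.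
rewrite (_ : (g * m ^+ 2 - s n) / (L * s n ^+ 2) = (m ^+ 2 / s n ^+ 2) * g / L - (L * s n)^-1);
  last by field; rewrite !gt_eqF.
have t1 : (t n)^-1 <= 1 by rewrite invf_le1.
(* Here [m^2 / s^2 = (N - K) / N], which is at least [1 - 1/t] as [K <= t^3] and [N = t^4]. *)
apply: lerB.
  rewrite ler_pM2r ?invr_gt0 ?L_gt0 //; apply: ler_pM => //; first by rewrite subr_ge0.
  rewrite ler_pdivlMr ?exprn_gt0 // s2 m2 ME -(t4 n).
  rewrite [leLHS](_ : _ = 2 * (t n ^+ 4 - t n ^+ 3)); last by field; rewrite gt_eqF.
  by rewrite ler_pM2l // lerD2l lerN2.
rewrite lef_pV2 ?posrE; first by rewrite ler_pM2l ?L_gt0 ?s_ge.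
  exact: mulr_gt0 L_gt0 s0.
exact: mulr_gt0 L_gt0 t0.
Qed.

Let t_inv_cvg : (t n)^-1 @[n --> \oo] --> (0 : R).
Proof.
apply/gtr0_cvgV0; last exact: t_cvg.
by near=> n; apply: lt_le_trans (t_ge1 n).
Unshelve. all: by end_near. Qed.

Let t_gauss_cvg : G ((t n - 1) / 2) @[n --> \oo] --> L.
Proof.
apply: (cvg_comp (fun n => (t n - 1) / 2) G _ (@integral0_gauss_cvg R)).
apply/cvgryPge => A; near=> n.
rewrite ler_pdivlMr // lerBrDr; near: n.
by move/cvgryPge: t_cvg; apply.
Unshelve. all: by end_near. Qed.

Lemma ratio_cvg : ratio n @[n --> \oo] --> (1 : R).
Proof.
move: t_gauss_cvg L_gt0 ratio_le ratio_ge; move: L => l gt l0 hi lo.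
have Lt : (l * t n)^-1 @[n --> \oo] --> (0 : R).
  rewrite -(mulr0 l^-1) (_ : (fun n => _) = (fun n => l^-1 * (t n)^-1)); last first.
    by apply/funext => n; rewrite invfM.
  exact: (cvgM (cvg_cst _) t_inv_cvg).
apply: (@squeeze_cvgr _ _ _ _ (fun n => (1 - (t n)^-1) * G ((t n - 1) / 2) / l - (l * t n)^-1)
  (fun n => 1 + 2 / (l * t n))).
- near=> n; have n0 : (0 < n)%N by near: n; exact: nbhs_infty_gt.
  rewrite hi // lo //; near: n.
  by move/cvgryPge: t_cvg; apply.
- rewrite [X in _ --> X](_ : 1 = (1 - 0) * l / l - 0); last first.
    by rewrite !subr0 mul1r divff // gt_eqF.
  exact: (cvgB (cvgM (cvgM (cvgB (cvg_cst _) t_inv_cvg) gt) (cvg_cst _)) Lt).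
- rewrite [X in _ --> X](_ : 1 = 1 + 2 * 0); last by rewrite mulr0 addr0.
  exact: (cvgD (cvg_cst _) (cvgM (cvg_cst _) Lt)).
Unshelve. all: by end_near. Qed.

(** With [q = 1 + 1/n] the quotient is [q^(n-1) / e], and [q^n <= e <= q^(n+1)] places it between
    [q^(-2)] and 1, where [q^(-1)] is [1 - harmonic n]. *)
Lemma pow_ratio_cvg :
  n.+1%:R ^+ n.-1 / (expR 1 * n%:R ^+ n.-1) @[n --> \oo] --> (1 : R).
Proof.
have cvg0 : (1 - harmonic n) @[n --> \oo] --> (1 : R).
  by rewrite -[X in _ --> X]subr0; apply: cvgB (@cvg_harmonic R); exact: cvg_cst.
apply: (@squeeze_cvgr _ _ _ _ (fun n => (1 - harmonic n) * (1 - harmonic n)) (fun=> 1)).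
- near=> n; have n0 : (0 < n)%N by near: n; exact: nbhs_infty_gt.
  have n0' : 0 < n%:R :> R by rewrite ltr0n.
  pose q : R := n.+1%:R / n%:R.
  have q0 : 0 < q by rewrite divr_gt0.
  have q1 : 1 <= q by rewrite ler_pdivlMr // mul1r ler_nat.
  have qV : 1 - harmonic n = q^-1.
    by rewrite /q invf_div /harmonic -[X in X / _](addrK 1) natr1 mulrBl divff ?mul1r.
  have qub : q ^+ n <= expR 1.
    apply: (@le_trans _ _ (expR n%:R^-1 ^+ n)); last by rewrite -expRM_natl divff // gt_eqF.
    rewrite ler_pXn2r ?nnegrE ?expR_ge0 ?(ltW q0) //.
    by apply: le_trans (expR_ge1Dx _); rewrite /q -natr1 mulrDl divff ?gt_eqF // mul1r.
  have qlb : expR 1 <= q ^+ n.+1.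
    apply: (@le_trans _ _ (expR n.+1%:R^-1 ^+ n.+1)).
      by rewrite -expRM_natl divff.
    rewrite ler_pXn2r ?nnegrE ?expR_ge0 ?(ltW q0) //.
    rewrite -[leLHS]invrK -expRN invf_ple ?posrE ?expR_gt0 // -qV.
    exact: expR_ge1Dx.
  rewrite qV (_ : _ / _ = q ^+ n.-1 / expR 1); last first.
    by rewrite /q expr_div_n invfM; ring.
  rewrite ler_pdivlMr ?expR_gt0 // ler_pdivrMr ?expR_gt0 // mul1r; apply/andP; split.
    rewrite -invfM [leLHS]mulrC ler_pdivrMr; last exact: mulr_gt0.
    apply: le_trans qlb _.
    by rewrite -[n in leLHS](prednK n0) !exprSr -mulrA.
  by apply: le_trans qub; rewrite -[n in leRHS](prednK n0) exprSr ler_peMr // exprn_ge0 // ltW.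
- by rewrite -[X in _ --> X](mulr1 1); exact: cvgM.
- exact: cvg_cst.
Unshelve. all: by end_near. Qed.

End Asymptotics.

Local Open Scope ring_scope.

Theorem lemma31 (R : realType) :
  asymp_equiv
    (fun n : nat => (connected_parking_count n)%:R : R)
    (fun n : nat => Num.sqrt (pi / 2) * expR 1 * n%:R `^ (n%:R - 3 / 2))
  /\
  asymp_equiv
    (fun n : nat => (connected_parking_count n)%:R / n.+1%:R ^+ n.-1 : R)
    (fun n : nat => Num.sqrt (pi / (2 * n%:R))).
Proof.
split; last exact: ratio_cvg.
(* The first quotient is the product of these two sequences for [n > 0], because
   [n^(n - 3/2) = n^(n-1) / sqrt n] and [sqrt (pi / (2n)) = sqrt (pi / 2) / sqrt n]. *)
have := cvgM (@ratio_cvg R) (@pow_ratio_cvg R); rewrite mulr1 => prod_cvg.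
apply: (cvg_trans _ (prod_cvg _)).
apply: near_eq_cvg; near=> n => /=.
have n0 : (0 < n)%N by near: n; exact: nbhs_infty_gt.
have n0' : 0 < n%:R :> R by rewrite ltr0n.
have sn : 0 < Num.sqrt n%:R :> R by rewrite sqrtr_gt0.
have sp : 0 < Num.sqrt (pi / 2) :> R by rewrite sqrtr_gt0 divr_gt0 // pi_gt0.
have -> : Num.sqrt (pi / (2 * n%:R)) = Num.sqrt (pi / 2) / Num.sqrt n%:R :> R.
  by rewrite invfM mulrA (@sqrtrM _ (pi / 2)) ?divr_ge0 ?pi_ge0 // sqrtrV.
have -> : n%:R `^ (n%:R - 3 / 2) = n%:R ^+ n.-1 / Num.sqrt n%:R :> R.
  rewrite -powR_mulrn // -powR12_sqrt // -powRB ?(gt_eqF n0') ?implybT //.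
  by congr (_ `^ _); rewrite -[n in LHS](prednK n0) -natr1; field.
have e0 : 0 < expR 1 :> R by exact: expR_gt0.
by field; rewrite ?expf_neq0 ?gt_eqF.
Unshelve. all: by end_near. Qed.
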